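(* Let $p$ be a prime, let $G$ be a finite group acting by group automorphisms on a finite elementary abelian $p$-group $E$, and let $G\ltimes E$ denote the corresponding semidirect product. If $\mathbb{F}$ is a sufficiently large field of characteristic $p$ (i.e. there is an integer $N$, depending only on $G$, $E$ and the action, such that the following holds for every field $\mathbb{F}$ of characteristic $p$ with $|\mathbb{F}|\geq N$), then there is a faithful representation of $G\ltimes E$ of dimension $|G|+1$ over $\mathbb{F}$.
   Context: A representation over $\mathbb{F}$ of dimension $d$ is a group homomorphism to $\mathrm{GL}_d(\mathbb{F})$; it is faithful if this homomorphism is injective. *)

(* Defs.v *)
From mathcomp Require Import all_boot.

Set Implicit Arguments.
Unset Strict Implicit.
Unset Printing Implicit Defensive.

(* [T] may be infinite, so its cardinal is bounded below through
   duplicate-free finite sequences of its elements. *)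
Definition card_at_least (T : eqType) (N : nat) : Prop :=
  exists2 s : seq T, uniq s & N <= size s.

(* Main.v *)
(** Let [chi] be an injective additive map from [E] to [F].  The group acts on
    [F (+) F[G]]: [G] acts through its regular representation on [F[G]], and
    [x] in [E] is the transvection that adds to the generator of [F] the
    vector [(chi (x ^ (h^-1)))_(h in G)].  Such a [chi] sends the coordinates
    [(v_i)] of [x] over the prime field to [\sum_i v_i t^i], where [t] avoids
    the roots of the finitely many nonzero polynomials of degree less than the
    rank of [E]. *)

Require Import Defs.
From mathcomp Require Import all_boot all_order all_algebra all_fingroup.
From mathcomp Require Import all_solvable all_field all_character.

Set Implicit Arguments.
Unset Strict Implicit.
Unset Printing Implicit Defensive.

Import GRing.Theory.
Local Open Scope ring_scope.

Lemma card_at_least_nonroot (R : idomainType) (q : {poly R}) :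
  q != 0 -> card_at_least R (size q) -> exists t, ~~ root q t.
Proof.
move=> nz_q [s Us le_qs].
have [rs | /allPn[t _ nrt]] := boolP (all (root q) s); last by exists t.
by have := max_poly_roots nz_q rs Us; rewrite ltnNge le_qs.
Qed.

Lemma Fp_rV_additive_inj (p n : nat) :
  exists N : nat, forall F : fieldType, p \in [pchar F] -> card_at_least F N ->
    exists f : {additive 'rV['F_p]_n -> F}, injective f.
Proof.
pose q : {poly 'F_p} := \prod_(v : 'rV['F_p]_n | v != 0) rVpoly v.
have nz_q : q != 0.
  apply/prodf_neq0=> v; apply: contra_neq => v0.
  by rewrite -[v]rVpolyK v0 linear0.
(* A nonzero polynomial has fewer roots than its size, and mapping [q] into a field extension keeps
   its size, so this bound serves every [F]. *)
exists (size q) => F charF bigF.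
(* [K] is [F] viewed as an algebra over its prime field. *)
pose K : fieldType := pPrimeCharType charF.
pose g : {rmorphism 'F_p -> K} := in_alg (pPrimeCharType charF).
have [||t] := @card_at_least_nonroot K (map_poly g q).
- by rewrite map_poly_eq0.
- by rewrite size_map_poly.
rewrite rmorph_prod rootE horner_prod => /prodf_neq0 nr_t.
pose f : {additive 'rV['F_p]_n -> K} := horner_eval t \o map_poly g \o rVpoly.
exists f.
apply: raddf_inj => v fv0; apply/eqP; apply: contraTT isT => /nr_t.
by rewrite [X in X != 0]fv0 eqxx.
Qed.

Lemma abelem_additive_inj (p : nat) (eT : finGroupType)
    (E : {group eT}) (abelE : (p.-abelem E)%g) :
  exists N : nat, forall F : fieldType, p \in [pchar F] -> card_at_least F N ->
    exists2 chi : eT -> F, {in E &, {morph chi : x y / (x * y)%g >-> x + y}}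
      & {in E &, injective chi}.
Proof.
(* The coordinates [abelem_rV] require [E] to be nontrivial. *)
have [E1 | ntE] := eqVneq (E : {set eT}) 1%g.
  exists 0 => F _ _; exists (fun=> 0) => [x y _ _ | x y]; first by rewrite addr0.
  by rewrite E1 => /set1P-> /set1P->.
have [N bigN] := Fp_rV_additive_inj p (abelem_dim' E).+1.
exists N => F charF /bigN[//|f f_inj].
exists (f \o abelem_rV abelE ntE) => [x y Ex Ey | x y Ex Ey /f_inj].
  by rewrite /= abelem_rV_M // raddfD.
exact: abelem_rV_inj.
Qed.

(** The matrix of [b] is a permutation matrix: its column at [h] has its only 1 in the row of
    [h * b^-1]. *)
Lemma row_mul_regular_mx (R : comUnitRingType) (gT : finGroupType) (G : {group gT})
    (v : 'rV[R]_#|G|) (b : gT) (j : 'I_#|G|) : b \in G ->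
  (v *m regular_repr R G b) 0 j = v 0 (gring_index G (enum_val j * b^-1)%g).
Proof.
move=> Gb; rewrite mxE (bigD1 (gring_index G (enum_val j * b^-1)%g)) //=.
have Gj : enum_val j \in G by apply: enum_valP.
rewrite !mxE gring_indexK ?groupM ?groupV // mulgKV gring_valK !eqxx mulr1.
rewrite big1 ?addr0 // => i ne_i; rewrite !mxE eqxx /=.
case: eqP => [def_j | _]; last by rewrite mulr0.
case/eqP: ne_i; rewrite def_j gring_indexK ?groupM ?enum_valP //.
by rewrite mulgK gring_valK.
Qed.

Section AffineRegular.

Variables (F : fieldType) (gT eT : finGroupType).
Variables (G : {group gT}) (E : {group eT}) (to : groupAction G E).
Variable chi : eT -> F.
Hypothesis chiM : {in E &, {morph chi : x y / (x * y)%g >-> x + y}}.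

(** The inverse turns the shift from [h] to [h * b^-1] into the action of [b] on [x], since
    [(h * b^-1)^-1 = b * h^-1] and [to] is a right action. *)
Definition orbit_row (x : eT) : 'rV[F]_#|G| :=
  \row_h chi (to x (enum_val h)^-1%g).

Definition affine_regular_mx (u : sdprod_by to) : 'M[F]_(1 + #|G|) :=
  block_mx 1%:M (orbit_row u.2) 0 (regular_repr F G u.1).

(** As [(a, x) * (b, y) = (a * b, to x b * y)], only the upper right block needs work: the row of
    [to x b] is the row of [x] times the regular matrix of [b], and [chi] is additive. *)
Lemma affine_regular_repr : mx_repr [set: sdprod_by to] affine_regular_mx.
Proof.
have chi1 : chi 1%g = 0.
  by apply: (addIr (chi 1%g)); rewrite -chiM // mulg1 add0r.
split=> [|[[a x] /= axP] [[b y] /= byP] _ _]; rewrite /affine_regular_mx /=.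
  rewrite (repr_mx1 (regular_repr F G)) (_ : orbit_row 1 = 0) -?scalar_mx_block //.
  by apply/rowP=> h; rewrite !mxE gact1 ?groupV ?enum_valP.
case/setXP: axP => Ga Ex; case/setXP: byP => Gb Ey.
rewrite mulmx_block !mul0mx !mulmx0 !mul1mx !add0r addr0.
rewrite (repr_mxM (regular_repr F G)) //; congr block_mx.
apply/rowP=> h; have Gh := enum_valP h.
rewrite [RHS]mxE row_mul_regular_mx // !mxE.
rewrite gring_indexK ?groupM ?groupV // invMg invgK (actMin to) ?groupV //.
by rewrite gactM ?groupV ?gact_stable // chiM ?gact_stable ?groupV // addrC.
Qed.

Canonical affine_regular_representation := MxRepresentation affine_regular_repr.

Lemma affine_regular_faithful :
  {in E &, injective chi} -> mx_faithful affine_regular_representation.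
Proof.
move=> chiI; apply/subsetP=> u; rewrite !inE /= mul1mx => /eqP.
rewrite -(repr_mx1 affine_regular_representation) /=.
case/eq_block_mx=> _ eq_row _ eq_reg.
case: u => [[a x] axP] /= in eq_row eq_reg *; have [Ga Ex] := setXP axP.
apply/eqP/val_inj => /=; congr (_, _).
  exact: (mx_faithful_inj (regular_mx_faithful F G)) eq_reg.
(* The coordinate at [h = 1] is [chi x] itself. *)
have := congr1 (fun v : 'rV_#|G| => v 0 (gring_index G 1%g)) eq_row.
by rewrite !mxE gring_indexK // invg1 !act1; apply: chiI.
Qed.

End AffineRegular.

Theorem theorem2p3 (p : nat) (p_pr : prime p)
    (gT eT : finGroupType) (G : {group gT}) (E : {group eT})
    (abelE : (p.-abelem E)%g) (to : groupAction G E) :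
  exists N : nat,
    forall (F : fieldType), p \in [pchar F]%R -> card_at_least F N ->
      exists rho : mx_representation F [set: sdprod_by to]%G #|G|.+1,
        mx_faithful rho.
Proof.
have [N bigN] := abelem_additive_inj abelE.
exists N => F charF /bigN[//|chi chiM chiI].
by exists (affine_regular_representation to chiM); apply: affine_regular_faithful.
Qed.
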